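(* Let $G$ be a directed graph with $n$ nodes and $m$ edges, let $\ell\in\mathbb N$ and $\phi\in(0,1]$. Algorithm $\mathsf{EdgeSampling}(\overrightarrow{\mathcal{O}},\ell,\phi)$ run on $G$ has query complexity at most $\min\{2(2n+\ell)/\phi,\ m\}$ and outputs an estimate $\hat n\le n$. Furthermore, if $G$ has general conductance $\phi_\varepsilon(G)\ge\phi$, then the algorithm's output satisfies $\hat n\ge(1-\varepsilon)n$ with probability at least $1-2^{-\ell}$.
   Context: Oracle $\overrightarrow{\mathcal{O}}$: graph stored with out-adjacency lists in arbitrary order; nodes reported via an injective labelling; on $\mathsf{init}$ it returns an arbitrary node $v$ with $\deg^+(v)$; on $(u,i,\mathsf{out})$ for an already revealed node $u$ and $i\le\deg^+(u)$ it returns the $i$-th out-neighbour of $u$ with its out-degree. Each query costs one unit. General conductance: for $\emptyset\ne S\subsetneq V$, $\deg^+(S)=|\{(u,v)\in E:u\in S\}|$, $\partial S=\{(u,v)\in E:u\in S,v\notin S\}$, $\phi(S)=|\partial S|/\deg^+(S)$; for $\varepsilon>0$, $\phi_\varepsilon(G)=\min\{\phi(S): S\subseteq V,\ 1\le|S|\le(1-\varepsilon)|V|\}$. Algorithm $\mathsf{EdgeSampling}(\overrightarrow{\mathcal{O}},\ell,\phi)$: set counter $Y=0$; query $\mathsf{init}$ to get node $v$; $S=\{v\}$; $E'=\{(v,i): i\le\deg^+(v)\}$ (undisclosed out-edge slots). While $Y\le\ell$: run a block of up to $2/\phi$ steps; in each step pick $(u,i)$ uniformly at random from $E'$, query $(u,i,\mathsf{out})$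 obtaining $w$, and remove $(u,i)$ from $E'$; if $w\notin S$, add $w$ to $S$, add $\{(w,i):i\le\deg^+(w)\}$ to $E'$, and end the block. After the block, if a new node was found set $Y\leftarrow Y-1$, otherwise $Y\leftarrow Y+1$. When the loop ends, output $\hat n=|S|$.
   Formalization: The bound m counts only the (u,i,out) queries, since with init counted it fails (one node, no edges); the bound 2(2n+ℓ)/φ is proved for all queries. φ(S) is taken as 0 when deg⁺(S)=0, and a block also ends when E' is empty. *)

(* Defs.v *)
From HB Require Import structures.
From mathcomp Require Import all_boot all_order all_algebra.
From mathcomp Require Import finmap reals.

Set Implicit Arguments.
Unset Strict Implicit.
Unset Printing Implicit Defensive.

Import Order.TTheory GRing.Theory Num.Theory.
Local Open Scope fset_scope.
Local Open Scope ring_scope.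

(* Finitely supported probability distributions, as weighted lists of outcomes
   (the same outcome may be listed several times; its probability is then the
   sum of the weights). *)
Record dist (R : realType) (T : Type) := Dist {
  weights :> seq (R * T);
  weights_gt0 : all (fun p => 0 < p.1) weights;
  weights_sum1 : \sum_(p <- weights) p.1 = 1 }.

Definition Pr (R : realType) (T : Type) (d : dist R T) (A : pred T) : R :=
  \sum_(p <- weights d | A p.2) p.1.

Definition surely (R : realType) (T : Type) (d : dist R T) (A : pred T) : bool :=
  all (fun p => A p.2) (weights d).

Lemma dret_gt0 (R : realType) (T : Type) (x : T) :
  all (fun p : R * T => 0 < p.1) [:: (1, x)].
Proof. by rewrite /= ltr01. Qed.

Lemma dret_sum1 (R : realType) (T : Type) (x : T) :
  \sum_(p <- [:: (1 : R, x)]) p.1 = 1.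
Proof. by rewrite big_seq1. Qed.

Definition dret (R : realType) (T : Type) (x : T) : dist R T :=
  Dist (dret_gt0 R x) (dret_sum1 R x).

Definition bind_weights (R : realType) (T U : Type) (d : dist R T)
    (f : T -> dist R U) : seq (R * U) :=
  flatten [seq [seq (p.1 * q.1, q.2) | q <- weights (f p.2)] | p <- weights d].

Lemma dbind_gt0 (R : realType) (T U : Type) (d : dist R T) (f : T -> dist R U) :
  all (fun p => 0 < p.1) (bind_weights d f).
Proof.
rewrite /bind_weights; have := weights_gt0 d.
elim: (weights d) => //= p s IHs /andP[p0 s0].
rewrite all_cat IHs // andbT all_map; apply: sub_all (weights_gt0 (f p.2)) => q /=.
exact: mulr_gt0.
Qed.

Lemma dbind_sum1 (R : realType) (T U : Type) (d : dist R T) (f : T -> dist R U) :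
  \sum_(p <- bind_weights d f) p.1 = 1.
Proof.
rewrite /bind_weights big_flatten big_map -[RHS](weights_sum1 d).
by apply: eq_bigr => p _; rewrite big_map -mulr_sumr weights_sum1 mulr1.
Qed.

Definition dbind (R : realType) (T U : Type) (d : dist R T)
    (f : T -> dist R U) : dist R U :=
  Dist (dbind_gt0 d f) (dbind_sum1 d f).

Definition uniform_weights (R : realType) (T : Type) (x : T) (s : seq T) :
    seq (R * T) :=
  [seq ((size s).+1%:R^-1, y) | y <- x :: s].

Lemma uniform_gt0 (R : realType) (T : Type) (x : T) (s : seq T) :
  all (fun p => 0 < p.1) (uniform_weights R x s).
Proof. by rewrite all_map; apply/allT => y /=; rewrite invr_gt0 ltr0n. Qed.

Lemma uniform_sum1 (R : realType) (T : Type) (x : T) (s : seq T) :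
  \sum_(p <- uniform_weights R x s) p.1 = 1.
Proof.
rewrite big_map big_const_seq count_predT iter_addr_0 /=.
by rewrite -[_ *+ _]mulr_natl divff // pnatr_eq0.
Qed.

(* Uniform distribution on the positions of the nonempty list x :: s. *)
Definition duniform (R : realType) (T : Type) (x : T) (s : seq T) : dist R T :=
  Dist (uniform_gt0 R x s) (uniform_sum1 R x s).

(* A directed graph on V is a relation E : rel V; self-loops are allowed. *)

Definition num_edges (V : finType) (E : rel V) : nat :=
  #|[set e : V * V | E e.1 e.2]|.

Definition outdeg_set (V : finType) (E : rel V) (S : {set V}) : nat :=
  #|[set e : V * V | E e.1 e.2 & e.1 \in S]|.

Definition boundary (V : finType) (E : rel V) (S : {set V}) : {set V * V} :=
  [set e : V * V | [&& E e.1 e.2, e.1 \in S & e.2 \notin S]].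

(* If no edge leaves a node of S the quotient is 0 / 0, which is 0 here: such an
   S has conductance 0, like every set without outgoing boundary edge. *)
Definition conductance (R : realType) (V : finType) (E : rel V) (S : {set V}) : R :=
  #|boundary E S|%:R / (outdeg_set E S)%:R.

(* Since conductance E S <= 1 always, the unit 1 of the iterated minimum only
   matters when the range is empty. *)
Definition gen_conductance (R : realType) (V : finType) (E : rel V) (eps : R) : R :=
  \big[Num.min/1]_(S : {set V} |
      (0 < #|S|)%N && (#|S|%:R <= (1 - eps) * #|V|%:R)) conductance R E S.

Record oracle (V : finType) (E : rel V) (L : choiceType) := Oracle {
  label : V -> L;
  label_inj : injective label;
  adj : V -> seq V;
  adj_perm : forall u, perm_eq (adj u) (enum (E u));
  start : V }.

Inductive query (L : Type) : Type :=
| Init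
| Out of L & nat.
Arguments Init {L}.

(* The label of the reported node, and its out-degree. *)
Definition answer (L : Type) : Type := (L * nat)%type.

Definition transcript (L : Type) : Type := seq (query L * answer L).

Definition report (V : finType) (E : rel V) (L : choiceType)
    (O : oracle E L) (v : V) : answer L :=
  (label O v, size (adj O v)).

(* Answer to q after the exchange h; None for an inadmissible query, i.e. one
   about a node not revealed in h or with an index outside 1, ..., deg+(u). *)
Definition respond (V : finType) (E : rel V) (L : choiceType)
    (O : oracle E L) (h : transcript L) (q : query L) : option (answer L) :=
  match q with
  | Init => Some (report O (start O))
  | Out a i =>
      if [pick v | label O v == a] is Some u then
        if (a \in [seq t.2.1 | t <- h]) && (0 < i <= size (adj O u))%N
        then Some (report O (nth u (adj O u) i.-1))
        else None
      else None
  end.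

(* The initial query is not counted: with it, an execution disclosing every edge
   makes num_edges E + 1 queries. *)
Definition out_queries (L : Type) (h : transcript L) : nat :=
  count (fun t => if t.1 is Out _ _ then true else false) h.

(* The sets S (labels seen so far) and E' (undisclosed out-edge slots), with the
   exchange with the oracle so far. *)
Record state (L : choiceType) := State {
  seen : {fset L};
  slots : {fset L * nat};
  history : transcript L }.

Definition node_slots (L : choiceType) (a : answer L) : {fset L * nat} :=
  [fset (a.1, i) | i in iota 1 a.2].

(* One block of at most k steps; the boolean tells whether a new node was found.
   A block also ends, unsuccessfully, when E' is empty.  None stands for an
   inadmissible query. *)
Fixpoint block (R : realType) (V : finType) (E : rel V) (L : choiceType)
    (O : oracle E L) (k : nat) (s : state L) : dist R (option (bool * state L)) :=
  if k is k'.+1 then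
    if enum_fset (slots s) is e0 :: es then
      dbind (duniform R e0 es) (fun e =>
        let q := Out e.1 e.2 in
        if respond O (history s) q is Some a then
          let slots' := slots s `\ e in
          let history' := rcons (history s) (q, a) in
          if a.1 \in seen s then block R O k' (State (seen s) slots' history')
          else dret R (Some (true,
            State (a.1 |` seen s) (slots' `|` node_slots a) history'))
        else dret R None)
    else dret R (Some (false, s))
  else dret R (Some (false, s)).

(* The while loop, cut off after fuel iterations.  An outcome Some (nhat, h) is
   a halted execution with output nhat and exchange h; None stands for an
   execution that was cut off or made an inadmissible query. *)
Fixpoint main_loop (R : realType) (V : finType) (E : rel V) (L : choiceType)
    (O : oracle E L) (l : nat) (phi : R) (fuel : nat) (Y : int) (s : state L) :
    dist R (option (nat * transcript L)) :=
  if Y <= l%:Z then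
    if fuel is fuel'.+1 then
      dbind (block R O (Num.truncn (2 / phi)) s) (fun o =>
        if o is Some (found, s') then
          main_loop O l phi fuel' (if found then Y - 1 else Y + 1) s'
        else dret R None)
    else dret R None
  else dret R (Some (#|` seen s|, history s)).

Definition edge_sampling (R : realType) (V : finType) (E : rel V) (L : choiceType)
    (O : oracle E L) (l : nat) (phi : R) (fuel : nat) :
    dist R (option (nat * transcript L)) :=
  if respond O [::] Init is Some a then
    main_loop O l phi fuel 0 (State [fset a.1] (node_slots a) [:: (Init, a)])
  else dret R None.

Definition halted_with (L : choiceType) (A : nat -> transcript L -> bool)
    (o : option (nat * transcript L)) : bool :=
  if o is Some (nhat, h) then A nhat h else false.

(* Main.v *)
Require Import Defs.
From HB Require Import structures.
From mathcomp Require Import all_boot all_order all_algebra.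
From mathcomp Require Import finmap reals boolp.
From mathcomp Require Import zify lra.

Set Implicit Arguments.
Unset Strict Implicit.
Unset Printing Implicit Defensive.

Import Order.TTheory GRing.Theory Num.Theory.
Local Open Scope ring_scope.

(** Every edge from a seen to an unseen node is still an undisclosed slot, and
    there are at most deg+(S) slots.  So while |S| <= (1 - eps) n each step finds
    a new node with probability at least phi, and a block fails with probability
    at most (1 - phi)^floor(2/phi) <= 1/3.  Hence 2^(Y - l - 1) is a
    supermartingale until |S| is large, and the loop stops too early with
    probability at most 2^(-l-1).  Halting and the query bound hold because
    2 (n - |S|) + (l + 1 - Y) decreases by one with each block: there are at most
    2n + l - 1 blocks, and the missing one pays for the initial query. *)

(** * Sure events and probabilities of finite distributions *)

Lemma surely_sub (R : realType) (T : Type) (d : dist R T) (A B : pred T) :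
  subpred A B -> surely d A -> surely d B.
Proof. by move=> sAB; apply: sub_all => p; apply: sAB. Qed.

Lemma surely_bind (R : realType) (T U : Type) (d : dist R T) (f : T -> dist R U)
    (A : pred T) (B : pred U) :
  surely d A -> (forall x, A x -> surely (f x) B) -> surely (dbind d f) B.
Proof.
rewrite /surely /= /bind_weights => dA AB; elim: (weights d) dA => //= p s IHs.
move=> /andP[Ap As]; rewrite all_cat IHs // andbT all_map.
exact: AB.
Qed.

Lemma surely_uniform (R : realType) (T : eqType) (x : T) (s : seq T) :
  surely (duniform R x s) (mem (x :: s)).
Proof. by rewrite /surely all_map; apply/allP => y. Qed.

Lemma surely_ret (R : realType) (T : Type) (x : T) (A : pred T) :
  surely (dret R x) A = A x.
Proof. by rewrite /surely /= andbT. Qed.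

Lemma Pr_ret (R : realType) (T : Type) (x : T) (A : pred T) :
  Pr (dret R x) A = (A x)%:R.
Proof. by rewrite /Pr big_mkcond big_seq1; case: (A x). Qed.

Lemma Pr_predC (R : realType) (T : Type) (d : dist R T) (A : pred T) :
  Pr d A = 1 - Pr d (predC A).
Proof. by rewrite -(weights_sum1 d) (bigID (fun p => A p.2)) /= addrK. Qed.

Lemma Pr_ge0 (R : realType) (T : Type) (d : dist R T) (A : pred T) : 0 <= Pr d A.
Proof.
rewrite /Pr; have := weights_gt0 d; elim: (weights d) => [|p s IHs] /=.
  by rewrite big_nil.
move=> /andP[p0 /IHs s0]; rewrite big_cons; case: ifP => // _.
by rewrite addr_ge0 // ltW.
Qed.

Lemma Pr_le1 (R : realType) (T : Type) (d : dist R T) (A : pred T) : Pr d A <= 1.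
Proof. by rewrite Pr_predC gerBl Pr_ge0. Qed.

Lemma Pr_surely (R : realType) (T : Type) (d : dist R T) (A : pred T) :
  surely d A -> Pr d A = 1.
Proof.
rewrite /surely /Pr -(weights_sum1 d).
elim: (weights d) => [|p s IHs] /=; first by rewrite !big_nil.
by move=> /andP[Ap /IHs IH]; rewrite !big_cons Ap IH.
Qed.

(** Total probability, split on [C]. The sure event [A] carries what the continuation may assume,
    such as the invariant after a block. *)
Lemma Pr_bind_le (R : realType) (T U : Type) (d : dist R T) (f : T -> dist R U)
    (A C : pred T) (B : pred U) (a b : R) :
  surely d A -> (forall x, A x -> Pr (f x) B <= if C x then a else b) ->
  Pr (dbind d f) B <= a * Pr d C + b * (1 - Pr d C).
Proof.
move=> dA le_f; rewrite -(weights_sum1 d) /Pr /= /bind_weights.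
move: dA (weights_gt0 d); rewrite /surely.
elim: (weights d) => [|p s IHs] /=.
  by rewrite !big_nil; lra.
move=> /andP[Ap /IHs{}IHs] /andP[p0 /IHs{}IHs].
rewrite big_cat /= big_map !big_cons /=.
have -> : \sum_(q <- f p.2 | B q.2) p.1 * q.1 = p.1 * Pr (f p.2) B.
  by rewrite mulr_sumr.
have := ler_wpM2l (ltW p0) (le_f _ Ap); case: (C p.2) => ?; lra.
Qed.

Lemma Pr_uniform (R : realType) (T : Type) (x : T) (s : seq T) (C : pred T) :
  Pr (duniform R x s) C = (count C (x :: s))%:R / (size (x :: s))%:R.
Proof. by rewrite /Pr big_map big_const_seq iter_addr_0 [RHS]mulr_natl. Qed.

(** * Adjacency lists, degree sums and slots *)

Lemma mem_adj (V : finType) (E : rel V) (L : choiceType) (O : oracle E L) (u w : V) :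
  (w \in adj O u) = E u w.
Proof. by rewrite (perm_mem (adj_perm O u)) mem_enum. Qed.

Lemma outdeg_set_adj (V : finType) (E : rel V) (L : choiceType) (O : oracle E L)
    (S : {set V}) : outdeg_set E S = (\sum_(u in S) size (adj O u))%N.
Proof.
under eq_bigr => u _ do rewrite (perm_size (adj_perm O u)) -cardE -sum1_card.
rewrite pair_big_dep /= sum1_card; apply: eq_card => e.
by rewrite !inE andbC; congr andb.
Qed.

Lemma num_edges_adj (V : finType) (E : rel V) (L : choiceType) (O : oracle E L) :
  num_edges E = (\sum_u size (adj O u))%N.
Proof.
rewrite (eq_bigl [in [set: V]]) => [|u]; last by rewrite inE.
by rewrite -outdeg_set_adj; apply: eq_card => e; rewrite !inE andbT.
Qed.

Lemma respond_out (V : finType) (E : rel V) (L : choiceType) (O : oracle E L)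
    (h : transcript L) (u : V) (i : nat) :
  label O u \in [seq t.2.1 | t <- h] -> (0 < i <= size (adj O u))%N ->
  respond O h (Out (label O u) i) = Some (report O (nth u (adj O u) i.-1)).
Proof.
move=> uh ui; rewrite /respond; case: pickP => [v /eqP /label_inj ->|/(_ u)].
  by rewrite uh ui.
by rewrite eqxx.
Qed.

Lemma in_node_slots (L : choiceType) (a : answer L) (e : L * nat) :
  (e \in node_slots a) = (e.1 == a.1) && (0 < e.2 <= a.2)%N.
Proof.
apply/imfsetP/idP => [[i /= ia ->]|/andP[/eqP e1 e2]] /=.
  by rewrite eqxx /=; move: ia; rewrite mem_iota; lia.
by exists e.2; rewrite /= ?mem_iota; [lia | rewrite -e1; case: e {e1 e2}].
Qed.

Lemma card_node_slots (L : choiceType) (a : answer L) : #|` node_slots a| = a.2.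
Proof.
rewrite card_imfset => [|i j []//]; rewrite /= undup_id ?size_iota //.
exact: iota_uniq.
Qed.

(** * The invariant and its preservation by a query *)

(* [out_deg_sum] makes every out-query consume a slot, so that no edge is
   disclosed twice; [disclosed] says that every edge leaving the seen nodes is
   still available in E'. *)
Record consistent (V : finType) (E : rel V) (L : choiceType) (O : oracle E L)
    (s : state L) : Prop := Consistent {
  seen_label : forall a, a \in seen s -> exists v, a = label O v;
  seen_history : {subset seen s <= [seq t.2.1 | t <- history s]};
  slot_label : forall e, e \in slots s -> exists u : V,
    [/\ label O u \in seen s, e.1 = label O u & (0 < e.2 <= size (adj O u))%N];
  disclosed : forall u i, label O u \in seen s -> (0 < i <= size (adj O u))%N ->
    (label O u, i) \notin slots s -> label O (nth u (adj O u) i.-1) \in seen s;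
  out_deg_sum : (#|` slots s| + out_queries (history s) =
    \sum_(u | label O u \in seen s) size (adj O u))%N;
  size_history : size (history s) = (out_queries (history s)).+1 }.

Lemma out_queries_rcons (L : Type) (h : transcript L) (a : L) (i : nat) (b : answer L) :
  out_queries (rcons h (Out a i, b)) = (out_queries h).+1.
Proof. by rewrite /out_queries -cats1 count_cat /= addn1. Qed.

(** The drawn slot belongs to a seen node, so the query is admissible. It trades one slot for one
    out-query; a new node also adds its out-degree both to the slots and to the degree sum. *)
Lemma consistent_query (V : finType) (E : rel V) (L : choiceType) (O : oracle E L)
    (s : state L) (e : L * nat) :
  consistent O s -> e \in slots s ->
  exists w : V, let a := report O w in
    let h := rcons (history s) (Out e.1 e.2, a) in
    respond O (history s) (Out e.1 e.2) = Some a /\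
    if a.1 \in seen s then consistent O (State (seen s) (slots s `\ e)%fset h)
    else consistent O
      (State (a.1 |` seen s)%fset ((slots s `\ e) `|` node_slots a)%fset h).
Proof.
move=> [lab hist slot disc cnt sz] es; have [u [us eu ei]] := slot _ es.
set w := nth u (adj O u) e.2.-1.
have resp : respond O (history s) (Out e.1 e.2) = Some (report O w).
  by rewrite eu respond_out ?hist.
exists w; split=> //; rewrite [(report O w).1]/=.
have cntD := cardfsD1 e (slots s); rewrite es add1n in cntD.
case: ifPn => ws.
  split=> /=.
  - exact: lab.
  - by move=> a /hist; rewrite map_rcons mem_rcons inE orbC => ->.
  - by move=> f; rewrite in_fsetD1 => /andP[_ /slot].
  (* A slot now missing either is [e], whose target [w] is seen, or was missing before. *)
  - move=> v i vs vi; rewrite in_fsetD1 negb_and negbK => /orP[/eqP ei'|].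
      have -> : v = u by apply: (@label_inj _ _ _ O); rewrite -eu -ei'.
      by move: ws; rewrite /w -ei'.
    exact: disc.
  - by rewrite out_queries_rcons -cnt cntD addnS.
  - by rewrite size_rcons out_queries_rcons sz.
split=> /=.
- by move=> a; rewrite in_fset1U => /orP[/eqP->|/lab//]; exists w.
- move=> a; rewrite in_fset1U map_rcons mem_rcons inE /=.
  by case/orP=> [->//|/hist->]; rewrite orbT.
- move=> f; rewrite in_fsetU in_fsetD1 in_node_slots /=.
  case/orP=> [/andP[_ /slot[v [vs fv fi]]]|/andP[/eqP fw fi]].
    by exists v; rewrite in_fset1U vs orbT.
  by exists w; rewrite in_fset1U eqxx.
(* All slots of the new node are present, so a missing slot again is [e] or was missing before. *)
- move=> v i; rewrite !in_fset1U in_fsetU in_node_slots in_fsetD1 /=.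
  move=> vs vi; rewrite !negb_or => /andP[ni nw].
  case/orP: vs => [/eqP /label_inj vw|vs].
    by move: nw; rewrite vw eqxx /= -vw vi.
  move: ni; rewrite negb_and negbK => /orP[/eqP ei'|ni].
    have -> : v = u by apply: (@label_inj _ _ _ O); rewrite -eu -ei'.
    by rewrite /w -ei' eqxx.
  by rewrite disc ?orbT.
- rewrite out_queries_rcons (bigD1 w) ?fset1U1 //=.
  rewrite (eq_bigl (fun v => label O v \in seen s)); last first.
    move=> v; rewrite in_fset1U; have [/label_inj ->|nv] := eqVneq (label O v) (label O w).
      by rewrite eqxx andbF (negPf ws).
    by rewrite /= (contra_neq _ nv) ?andbT // => ->.
  rewrite -cnt cntD.
  (* Old slots carry labels of seen nodes and [w] is unseen, so no slot is counted twice. *)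
  have dis : ((slots s `\ e) `&` node_slots (report O w))%fset = fset0.
    apply/fsetP => f; rewrite in_fsetI in_node_slots in_fsetD1 in_fset0.
    apply/negP => /andP[/andP[_ /slot[v [vs fv _]]] /andP[/eqP fw _]].
    by move: ws; rewrite -[label O w]fw fv vs.
  have := cardfsUI (slots s `\ e)%fset (node_slots (report O w)).
  by rewrite dis cardfs0 card_node_slots addn0 => ->; rewrite /=; lia.
- by rewrite size_rcons out_queries_rcons sz.
Qed.

(** * Seen nodes as a vertex set, boundary edges as slots *)

Definition seen_nodes (V : finType) (E : rel V) (L : choiceType) (O : oracle E L)
    (s : state L) : {set V} := [set v | label O v \in seen s].

Lemma card_seen (V : finType) (E : rel V) (L : choiceType) (O : oracle E L)
    (s : state L) : consistent O s -> #|` seen s| = #|seen_nodes O s|.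
Proof.
case=> lab _ _ _ _ _.
have -> : seen s = [fset label O v | v in seen_nodes O s]%fset.
  apply/fsetP => a; apply/idP/imfsetP => [as_|[v /= + ->]]; last by rewrite inE.
  by have [v av] := lab _ as_; exists v => //=; rewrite inE -av.
by rewrite card_imfset ?cardE //; apply: label_inj.
Qed.

Lemma slots_outdeg (V : finType) (E : rel V) (L : choiceType) (O : oracle E L)
    (s : state L) : consistent O s ->
  (#|` slots s| + out_queries (history s))%N = outdeg_set E (seen_nodes O s).
Proof.
move=> /out_deg_sum ->; rewrite (outdeg_set_adj O); apply: eq_bigl => u.
by rewrite inE.
Qed.

Lemma out_queries_edges (V : finType) (E : rel V) (L : choiceType) (O : oracle E L)
    (s : state L) : consistent O s -> (out_queries (history s) <= num_edges E)%N.
Proof.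
move=> /slots_outdeg cs; apply: (leq_trans (leq_addl #|` slots s| _)); rewrite {}cs.
apply: subset_leq_card; apply/subsetP => e.
by rewrite !inE => /andP[].
Qed.

Definition reveals (V : finType) (E : rel V) (L : choiceType) (O : oracle E L)
    (s : state L) (e : L * nat) : bool :=
  if respond O (history s) (Out e.1 e.2) is Some a then a.1 \notin seen s else false.

(** A boundary edge [(u, w)] is sent injectively to the slot given by the label of [u] and the
    position of [w] in [adj O u]. By [disclosed] this slot is still available, since otherwise [w]
    would be seen. *)
Lemma boundary_reveals (V : finType) (E : rel V) (L : choiceType) (O : oracle E L)
    (s : state L) : consistent O s ->
  (#|boundary E (seen_nodes O s)| <= count (reveals O s) (slots s))%N.
Proof.
move=> [lab hist slot disc cnt sz]; rewrite -size_filter cardE.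
pose g (e : V * V) := (label O e.1, (index e.2 (adj O e.1)).+1).
rewrite -(size_map g); apply: uniq_leq_size.
  rewrite map_inj_in_uniq ?enum_uniq // => -[u w] [u' w'].
  rewrite !mem_enum !inE /= => /and3P[Euw _ _] /and3P[Euw' _ _] [/label_inj uu'].
  rewrite -{}uu' in Euw' *; rewrite -(mem_adj O) in Euw; rewrite -(mem_adj O) in Euw'.
  by move=> ww'; rewrite -(nth_index u Euw) ww' nth_index.
move=> f /mapP[[u w]]; rewrite mem_enum !inE /= => /and3P[Euw us nw] ->{f}.
rewrite -(mem_adj O) in Euw.
have iu : (0 < (index w (adj O u)).+1 <= size (adj O u))%N by rewrite /= index_mem.
rewrite mem_filter; apply/andP; split.
  by rewrite /reveals respond_out ?hist //= nth_index.
by apply: contraNT nw => /(disc _ _ us iu); rewrite /= nth_index.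
Qed.

(** * Outcome and failure probability of one block *)

Definition found_new (L : choiceType) (o : option (bool * state L)) : bool :=
  if o is Some (b, _) then b else false.

(** The boolean [b] counts as 0 or 1: a block adds one node exactly when it reports success.
    Rejecting [None] records that every query was admissible. *)
Definition block_outcome (V : finType) (E : rel V) (L : choiceType) (O : oracle E L)
    (k : nat) (s : state L) (o : option (bool * state L)) : bool :=
  if o is Some (b, s') then
    [&& `[< consistent O s' >], #|` seen s'| == (#|` seen s| + b)%N &
        (out_queries (history s') <= out_queries (history s) + k)%N]
  else false.

(** Named so that the sure and the probabilistic analysis of a block share the case of one drawn
    slot. *)
Definition block_step (R : realType) (V : finType) (E : rel V) (L : choiceType)
    (O : oracle E L) (k : nat) (s : state L) (e : L * nat) :
    dist R (option (bool * state L)) :=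
  if respond O (history s) (Out e.1 e.2) is Some a then
    let h := rcons (history s) (Out e.1 e.2, a) in
    if a.1 \in seen s then block R O k (State (seen s) (slots s `\ e)%fset h)
    else dret R (Some (true,
      State (a.1 |` seen s)%fset ((slots s `\ e) `|` node_slots a)%fset h))
  else dret R None.

Lemma blockS (R : realType) (V : finType) (E : rel V) (L : choiceType)
    (O : oracle E L) (k : nat) (s : state L) :
  block R O k.+1 s =
    if enum_fset (slots s) is e0 :: es then
      dbind (duniform R e0 es) (block_step R O k s)
    else dret R (Some (false, s)).
Proof. by []. Qed.

Lemma block_surely (R : realType) (V : finType) (E : rel V) (L : choiceType)
    (O : oracle E L) (k : nat) (s : state L) :
  consistent O s -> surely (block R O k s) (block_outcome O k s).
Proof.
elim: k s => [|k IHk] s cs; rewrite ?blockS.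
  by rewrite surely_ret /=; apply/and3P; split; [exact/asboolP|lia|lia].
case defs: (enum_fset (slots s)) => [|e0 es].
  by rewrite surely_ret /=; apply/and3P; split; [exact/asboolP|lia|lia].
apply: surely_bind (surely_uniform R e0 es) _ => e e_s.
have ein : e \in slots s by rewrite -[_ \in _]/(e \in enum_fset (slots s)) defs.
rewrite /block_step; have [w [-> cw]] := consistent_query cs ein.
move: cw; case: ifPn => ws cw.
  apply: surely_sub (IHk _ cw) => -[[b s']|] //=.
  by rewrite out_queries_rcons addSnnS.
rewrite surely_ret /= out_queries_rcons cardfsU1 ws eqn_leq; apply/and3P.
by split; [exact/asboolP|lia|lia].
Qed.

(** By [boundary_reveals] and [slots_outdeg], the share of slots that reveal a new node is at least
    the conductance. A failing step leaves the seen set unchanged, so the hypothesis passes to the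
    remaining steps. *)
Lemma block_fail_prob (R : realType) (V : finType) (E : rel V) (L : choiceType)
    (O : oracle E L) (phi : R) (k : nat) (s : state L) :
  consistent O s -> 0 < phi -> phi <= conductance R E (seen_nodes O s) ->
  Pr (block R O k s) (predC (@found_new L)) <= (1 - phi) ^+ k.
Proof.
elim: k s => [|k IHk] s cs phi0 phis; rewrite ?blockS.
  by rewrite expr0 Pr_le1.
have bound := boundary_reveals cs; have deg := slots_outdeg cs.
(* As division by 0 gives 0, positive conductance excludes both an empty boundary and out-degree
   0. *)
have bS0 : 0 < (#|boundary E (seen_nodes O s)|%:R : R).
  rewrite ltr0n lt0n; apply/eqP => b0.
  by move: phis; rewrite /conductance b0 mul0r leNgt phi0.
have dS0 : 0 < ((outdeg_set E (seen_nodes O s))%:R : R).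
  rewrite ltr0n lt0n; apply/eqP => b0.
  by move: phis; rewrite /conductance b0 invr0 mulr0 leNgt phi0.
(* Without slots there would be no boundary edge. *)
case defs: (enum_fset (slots s)) => [|e0 es].
  by move: bS0; rewrite ltr0n; move: bound; rewrite defs /=; lia.
have phi1 : 0 <= 1 - phi.
  rewrite subr_ge0 (le_trans phis) // ler_pdivrMr // mul1r ler_nat.
  by apply: subset_leq_card; apply/subsetP => e; rewrite !inE => /and3P[-> ->].
have step e : e \in slots s ->
    Pr (block_step R O k s e) (predC (@found_new L)) <=
      if reveals O s e then 0 else (1 - phi) ^+ k.
  move=> ein; rewrite /reveals /block_step; have [w [-> cw]] := consistent_query cs ein.
  move: cw; case: ifPn => ws cw /=; first exact: IHk.
  by rewrite Pr_ret.
apply: le_trans (Pr_bind_le (surely_uniform R e0 es) _) _.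
  by move=> e e_s; apply: step; rewrite -[_ \in _]/(e \in enum_fset (slots s)) defs.
rewrite mul0r add0r exprSr ler_wpM2l ?exprn_ge0 // lerD2l lerN2 Pr_uniform -defs.
apply: le_trans phis _; rewrite /conductance.
apply: ler_pM; rewrite ?invr_ge0 ?ler_nat //.
rewrite lef_pV2 ?posrE // ?ler_nat; first by move: deg; rewrite cardfE -cardfE; lia.
by rewrite defs ltr0n.
Qed.

(** * Conductance of small sets and the block length *)

Lemma conductance_ge (R : realType) (V : finType) (E : rel V) (eps phi : R)
    (S : {set V}) :
  phi <= gen_conductance E eps -> (0 < #|S|)%N -> #|S|%:R <= (1 - eps) * #|V|%:R ->
  phi <= conductance R E S.
Proof.
move=> phiE S0 SV; apply: le_trans phiE _; rewrite /gen_conductance.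
by apply: bigmin_le_cond; rewrite S0.
Qed.

(** The constant 1/3 is the largest [q] with [(1 - q) / 4 + q <= 1 / 2], the supermartingale
    condition in [main_loop_fail_prob]. *)
Lemma one_sub_exp_block_length (R : realType) (phi : R) :
  0 < phi -> phi <= 1 -> (1 - phi) ^+ Num.truncn (2 / phi) <= 3^-1.
Proof.
move=> phi0 phi1; set k := Num.truncn _.
have k2 : (2 <= k)%N.
  by rewrite truncn_ge_nat; [rewrite ler_pdivlMr //; lra | rewrite divr_ge0 // ltW].
have kphi : 2 < k.+1%:R * phi by rewrite -ltr_pdivrMr // truncnS_gt.
have [half|half] := leP (2^-1) phi.
  (* For [phi >= 1/2] two steps suffice, as [(1/2)^2 <= 1/3]. *)
  rewrite -(subnK k2) exprD; apply: le_trans (_ : 1 * (1 - phi) ^+ 2 <= _).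
    by rewrite ler_wpM2r ?exprn_ge0 ?exprn_ile1 //; lra.
  rewrite mul1r; nra.
(* Since (1 - phi) (1 + phi) <= 1, it suffices to bound (1 + phi)^k from below by
   its second-order expansion; the first-order one only gives 1/2. *)
have low m : 1 + m%:R * phi + m%:R * (m%:R - 1) / 2 * phi ^+ 2 <= (1 + phi) ^+ m.
  elim: m => [|m IHm]; first by rewrite expr0; lra.
  have phi2 : 0 <= 1 + phi by lra.
  rewrite [leRHS]exprSr; apply: le_trans (ler_wpM2r phi2 IHm); rewrite -natr1; set x := (m%:R : R).
  (* This cubic term is the excess of [1 + phi] times the bound for [m] over the bound for
     [m + 1]. *)
  have : 0 <= x * (x - 1) / 2 * phi ^+ 3.
    suff : 0 <= x * (x - 1).
      by move=> x0; rewrite mulr_ge0 ?divr_ge0 ?exprn_ge0 // (ltW phi0).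
    rewrite {}/x; case: m {IHm} => [|m]; first by rewrite mul0r.
    by rewrite -natr1 addrK mulr_ge0 // addr_ge0.
  by nra.
(* Since [k * phi > 2 - phi], the expansion is at least [5 - 4 * phi + phi^2], which exceeds 3 for
   [phi < 1/2]. *)
have {}low : 3 <= (1 + phi) ^+ k.
  apply: le_trans (low k); rewrite -natr1 in kphi.
  set x := (k%:R : R) in kphi *.
  have h1 : 2 - phi <= x * phi by lra.
  have h2 : 2 - 2 * phi <= x * phi - phi by lra.
  have : (2 - phi) * (2 - 2 * phi) <= (x * phi) * (x * phi - phi).
    by apply: ler_pM => //; lra.
  by nra.
have : (1 - phi) ^+ k * (1 + phi) ^+ k <= 1.
  by rewrite -exprMn exprn_ile1 //; nra.
have : 0 <= (1 - phi) ^+ k by rewrite exprn_ge0 //; lra.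
by nra.
Qed.

(** * Halting, query bound and failure probability of the main loop *)

Lemma card_seen_le (V : finType) (E : rel V) (L : choiceType) (O : oracle E L)
    (s : state L) : consistent O s -> (#|` seen s| <= #|V|)%N.
Proof. by move=> /card_seen ->; apply: max_card. Qed.

(* With [y] further net failures needed to stop, each block decreases
   [2 * (#|V| - #|seen|) + y] by one. *)
Lemma main_loop_surely (R : realType) (V : finType) (E : rel V) (L : choiceType)
    (O : oracle E L) (l : nat) (phi : R) (fuel y : nat) (s : state L) :
  consistent O s -> (2 * (#|V| - #|` seen s|) + y <= fuel)%N ->
  surely (main_loop O l phi fuel (l.+1%:Z - y%:Z) s) (halted_with (fun nhat h =>
    [&& (#|` seen s| <= nhat <= #|V|)%N, (out_queries h <= num_edges E)%N,
        size h == (out_queries h).+1 &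
        (out_queries h <= out_queries (history s) +
          Num.truncn (2 / phi)%R * (2 * (#|V| - #|` seen s|) + y))%N])).
Proof.
set k := Num.truncn _; elim: fuel y s => [|fuel IHf] y s cs fuel_y /=.
  (* Fuel 0 forces the counter to be [l + 1], so the loop has already halted and is not cut off. *)
  have -> : y = 0%N by lia.
  rewrite ifF; last by lia.
  rewrite surely_ret /= (card_seen_le cs) (out_queries_edges cs) (size_history cs) eqxx.
  by rewrite leqnn leq_addr.
have sV := card_seen_le cs; case: ifPn => Yl; last first.
  rewrite surely_ret /= (card_seen_le cs) (out_queries_edges cs) (size_history cs) eqxx.
  by rewrite leqnn leq_addr.
apply: surely_bind (block_surely R k cs) _ => -[[b s']|] //=.
case/and3P=> /asboolP cs' /eqP sb qk; have sV' := card_seen_le cs'.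
pose y' := if b then y.+1 else y.-1.
have -> : (if b then l.+1%:Z - y%:Z - 1 else l.+1%:Z - y%:Z + 1) = l.+1%:Z - y'%:Z.
  by rewrite /y'; case: (b); lia.
(* Success changes the potential by -2 + 1; failure lowers [y], which is positive because the loop
   test passed. *)
have less : (2 * (#|V| - #|` seen s'|) + y' < 2 * (#|V| - #|` seen s|) + y)%N.
  by rewrite /y'; case: (b) sb; lia.
apply: surely_sub (IHf y' s' cs' _); last by lia.
case=> // -[nhat h] /= /and4P[nh -> -> qh]; rewrite !andTb; apply/andP; split.
  by move: nh; lia.
by apply: leq_trans qh _; nia.
Qed.

(* [2 ^- y] is a supermartingale along the loop, since a block fails with
   probability at most 1/3 as long as few nodes are seen. *)
Lemma main_loop_fail_prob (R : realType) (V : finType) (E : rel V) (L : choiceType)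
    (O : oracle E L) (l : nat) (phi eps : R) (fuel y : nat) (s : state L) :
  0 < phi -> phi <= 1 -> phi <= gen_conductance E eps ->
  consistent O s -> (0 < #|` seen s|)%N ->
  (2 * (#|V| - #|` seen s|) + y <= fuel)%N ->
  Pr (main_loop O l phi fuel (l.+1%:Z - y%:Z) s)
    (predC (halted_with (fun nhat _ => (1 - eps) * #|V|%:R <= nhat%:R))) <= 2 ^- y.
Proof.
move=> phi0 phi1 phiE; elim: fuel y s => [|fuel IHf] y s cs s0 fuel_y.
  have -> : y = 0%N by lia.
  by rewrite expr0 invr1 Pr_le1.
(* Seen nodes are never lost, so once enough are seen the output is surely large enough. *)
have [many|few] := leP ((1 - eps) * #|V|%:R) (#|` seen s|%:R).
  have := Pr_predC (main_loop O l phi fuel.+1 (l.+1%:Z - y%:Z) s)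
    (halted_with (fun nhat _ => (1 - eps) * #|V|%:R <= nhat%:R)).
  rewrite Pr_surely => [eq1|]; last first.
    apply: surely_sub (main_loop_surely l phi cs fuel_y) => -[[nhat h]|] //=.
    case/and4P=> /andP[sn _] _ _ _; apply: le_trans many _; by rewrite ler_nat.
  have : 0 <= 2 ^- y :> R by rewrite invr_ge0 exprn_ge0.
  by move: eq1; lra.
case: y fuel_y => [|y] fuel_y; first by rewrite expr0 invr1 Pr_le1.
rewrite [main_loop _ _ _ _ _ _]/= ifT; last by lia.
have sV := card_seen_le cs; set k := Num.truncn _.
have le_q : Pr (block R O k s) (predC (@found_new L)) <= 3^-1.
  apply: le_trans (one_sub_exp_block_length phi0 phi1); apply: block_fail_prob => //.
  by apply: conductance_ge phiE _ _; rewrite -(card_seen cs) // ltW.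
apply: le_trans (Pr_bind_le (a := 2 ^- y.+2) (b := 2 ^- y)
  (C := @found_new L) (block_surely R k cs) _) _.
  case=> [[b s']|] //= /and3P[/asboolP cs' /eqP sb _].
  have sV' := card_seen_le cs'.
  pose y' := if b then y.+2 else y.
  have -> : (if b then l.+1%:Z - y.+1%:Z - 1 else l.+1%:Z - y.+1%:Z + 1)
      = l.+1%:Z - y'%:Z by rewrite /y'; case: (b); lia.
  have -> : (if b then 2 ^- y.+2 else 2 ^- y) = 2 ^- y' :> R by rewrite /y'; case: (b).
  by apply: IHf => //; rewrite /y'; case: (b) sb; lia.
rewrite (Pr_predC _ (@found_new L)) !exprS !invfM; set p := Pr _ _ in le_q *.
have z0 : 0 <= 2 ^- y :> R by rewrite invr_ge0 exprn_ge0.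
by have := ler_wpM2l z0 le_q; lra.
Qed.

(** * The initial state and the final bounds *)

Lemma consistent_init (V : finType) (E : rel V) (L : choiceType) (O : oracle E L) :
  let a := report O (start O) in
  consistent O (State [fset a.1]%fset (node_slots a) [:: (Init, a)]).
Proof.
split=> //=.
- by move=> a; rewrite in_fset1 => /eqP ->; exists (start O).
- by move=> a; rewrite in_fset1 inE.
- move=> e; rewrite in_node_slots => /andP[/eqP e1 e2].
  by exists (start O); rewrite in_fset1 eqxx.
- move=> u i; rewrite in_fset1 => /eqP /label_inj ->.
  by rewrite in_node_slots /= eqxx => ->.
- rewrite card_node_slots (eq_bigl (pred1 (start O))) => [|u]; last first.
    by rewrite in_fset1 (inj_eq (@label_inj _ _ _ O)).
  by rewrite big_pred1_eq /= !addn0.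
Qed.

Theorem theorem5 (R : realType) (V : finType) (E : rel V) (L : choiceType)
    (O : oracle E L) (l : nat) (phi : R) (hphi0 : 0 < phi) (hphi1 : phi <= 1) :
  exists N : nat, forall fuel : nat, (N <= fuel)%N ->
    let run := edge_sampling O l phi fuel in
    [/\ surely run (halted_with (fun _ h =>
          (out_queries h)%:R <=
            Num.min (2 * (2 * #|V|%:R + l%:R) / phi) (num_edges E)%:R)),
        surely run (halted_with (fun _ h =>
          (size h)%:R <= 2 * (2 * #|V|%:R + l%:R) / phi)),
        surely run (halted_with (fun nhat _ => (nhat <= #|V|)%N))
      & forall eps : R, 0 < eps -> phi <= gen_conductance E eps ->
          1 - 2 ^- l <=
            Pr run (halted_with (fun nhat _ => (1 - eps) * #|V|%:R <= nhat%:R))].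
Proof.
(* With one node seen, the initial potential is [2 (n - 1) + l + 1 = 2n + l - 1], which this fuel
   covers. *)
exists (2 * #|V| + l)%N => fuel fuelN run.
have cs := consistent_init O; cbv zeta in cs; set s := State _ _ _ in cs.
have s1 : #|` seen s| = 1%N by rewrite cardfs1.
have V0 : (0 < #|V|)%N by apply/card_gt0P; exists (start O).
have fuel_l : (2 * (#|V| - #|` seen s|) + l.+1 <= fuel)%N by rewrite s1; lia.
have runE : run = main_loop O l phi fuel (l.+1%:Z - l.+1%:Z) s by rewrite subrr.
have sure := main_loop_surely l phi cs fuel_l; rewrite -runE in sure.
have {}sure : surely run (halted_with (fun nhat h =>
    [&& (nhat <= #|V|)%N, (out_queries h <= num_edges E)%N,
        (out_queries h <= size h)%N &
        (size h)%:R <= 2 * (2 * #|V|%:R + l%:R) / phi])).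
  apply: surely_sub sure => -[[nhat h]|] //= /and4P[/andP[_ ->] -> /eqP -> qh].
  rewrite leqnSn /=; move: qh; rewrite s1 add0n; set k := Num.truncn _ => qh.
  have phi2 : 1 <= 2 / phi by rewrite ler_pdivlMr //; lra.
  have k2 : k%:R <= 2 / phi by rewrite truncn_le; lra.
  (* The summand 1 is the initial query; as [1 <= 2 / phi], it fits into the one block by which the
     count stays below [2n + l]. *)
  have {}qh : ((out_queries h).+1%:R <= 1 + k%:R * (2 * #|V|%:R + l%:R - 1) :> R).
    have -> : 2 * #|V|%:R + l%:R - 1 = (2 * (#|V| - 1) + l.+1)%:R :> R.
      by rewrite natrD natrM natrB // -natr1; lra.
    by rewrite -natr1 addrC lerD2l -natrM ler_nat.
  apply: le_trans qh _; rewrite [leRHS]mulrAC.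
  have x0 : 0 <= 2 * #|V|%:R + l%:R - 1 :> R.
    have V1 : 1 <= #|V|%:R :> R by rewrite ler1n.
    by have := ler0n R l; lra.
  by have := ler_wpM2r x0 k2; lra.
split.
- apply: surely_sub sure => -[[nhat h]|] //= /and4P[_ qm qs sh].
  by rewrite le_min ler_nat qm andbT (le_trans _ sh) // ler_nat.
- by apply: surely_sub sure => -[[nhat h]|] //= /and4P[].
- by apply: surely_sub sure => -[[nhat h]|] //= /and4P[].
move=> eps _ phiE; rewrite Pr_predC lerD2l lerN2 runE.
apply: le_trans (main_loop_fail_prob _ hphi0 hphi1 phiE cs _ fuel_l) _.
  by rewrite s1.
(* The bound obtained is [2^-(l + 1)], half of what is allowed. *)
by rewrite lef_pV2 ?posrE ?exprn_gt0 // ler_eXn2l ?ltr1n.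
Qed.
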